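(* No graph in the class $\mathcal R$ is box-perfect.
   Context: All graphs are finite and simple. Box-perfectness. A rational system $A\boldsymbol x\le \boldsymbol b$ is totally dual integral (TDI) if the minimum in $\max\{\boldsymbol w^T\boldsymbol x: A\boldsymbol x\le \boldsymbol b\}=\min\{\boldsymbol y^T\boldsymbol b:\boldsymbol y^TA=\boldsymbol w^T,\ \boldsymbol y\ge \boldsymbol 0\}$ has an integral optimal solution for every integral vector $\boldsymbol w$ for which the minimum is finite. It is box-TDI if the system $A\boldsymbol x\le \boldsymbol b$, $\boldsymbol l\le \boldsymbol x\le \boldsymbol u$ is TDI for all vectors $\boldsymbol l,\boldsymbol u$ each of whose coordinates is a rational number or $\pm\infty$. For a graph $G$, $A_G$ is the clique-vertex incidence matrix of $G$ (rows indexed by all cliques, columns by vertices). $G$ is box-perfect if the system $A_G\boldsymbol x\le \boldsymbol 1$, $\boldsymbol x\ge \boldsymbol 0$ is box-TDI. The class $\mathcal Q$. A matrix is totally unimodular if every square submatrix has determinant $0$ or $\pm1$. For a bipartite graph $G=(U,V,E)$ with colour classes $U=\{u_1,\dots,u_m\}$, $V=\{v_1,\dots,v_n\}$, the biadjacency matrix is the $m\times n$ $\{0,1\}$-matrix $M$ with $M_{i,j}=1$ iff $u_iv_j\in E$. $\mathcal Q$ is the set of bipartite graphs $G=(U,V,E)$ whose biadjacency matrix $M$ is not totally unimodular but all of whose proper submatrices are totally unimodular. (It is a theorem of Camion that then $|U|=|V|$.) The class $\mathcal R$. Take $G'=(U,V,E')\in\mathcal Q$ and a graph $G''=(V,E'')$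 on the vertex set $V$ such that $N_{G'}(u)$ is a clique of $G''$ for every $u\in U$ (where $N_{G'}(u)$ is the set of neighbours of $u$ in $G'$). Let $G=(U\cup V,E'\cup E'')$. If there exists $u\in U$ with $N_{G'}(u)=V$, then $G-u$ belongs to $\mathcal R$; otherwise $G$ belongs to $\mathcal R$. The class $\mathcal R$ consists of all graphs obtained in this way. *)

(* Defs.v *)
From HB Require Import structures.
From mathcomp Require Import all_boot all_order all_algebra.
From mathcomp Require Import constructive_ereal.

Set Implicit Arguments.
Unset Strict Implicit.
Unset Printing Implicit Defensive.

Import Order.TTheory GRing.Theory Num.Theory.
Local Open Scope ring_scope.

(** * Linear systems and total dual integrality *)

(* A rational system A x <= b in variables x_v, v : V. *)
Record linsys (V : finType) := LinSys {
  ineq : finType;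
  lhs : ineq -> V -> rat;
  rhs : ineq -> rat }.

Section TDI.
Variables (V : finType) (S : linsys V).

Definition dual_feasible (w : V -> int) (y : ineq S -> rat) : Prop :=
  (forall i, 0 <= y i) /\
  (forall v, \sum_i y i * lhs i v = (w v)%:~R).

Definition dual_value (y : ineq S -> rat) : rat := \sum_i y i * rhs i.

Definition dual_optimal (w : V -> int) (y : ineq S -> rat) : Prop :=
  dual_feasible w y /\
  (forall z, dual_feasible w z -> dual_value y <= dual_value z).

(* The minimum is finite exactly when it is attained. *)
Definition TDI : Prop :=
  forall w : V -> int,
    (exists y, dual_optimal w y) ->
    exists2 y, dual_optimal w y & forall i, y i \is a Num.int.

(* Adds the inequalities - x_v <= - l_v and x_v <= u_v for the finite
   coordinates of l and u. *)
Definition add_box (l u : V -> \bar rat) : linsys V :=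
  @LinSys V
    (ineq S + ({v : V | l v \is a fin_num} + {v : V | u v \is a fin_num}))%type
    (fun i v => match i with
                | inl j => lhs j v
                | inr (inl a) => - (v == val a)%:R
                | inr (inr a) => (v == val a)%:R
                end)
    (fun i => match i with
              | inl j => rhs j
              | inr (inl a) => - fine (l (val a))
              | inr (inr a) => fine (u (val a))
              end).

End TDI.

(* A lower bound +oo or an upper bound -oo is left out: it makes the system
   infeasible, hence the dual minimum is never finite. *)
Definition box_TDI (V : finType) (S : linsys V) : Prop :=
  forall l u : V -> \bar rat,
    (forall v, l v != +oo%E) -> (forall v, u v != -oo%E) ->
    TDI (add_box S l u).

(** * Graphs and box-perfectness *)

Record sgraph := SGraph {
  vertex :> finType;
  adj : rel vertex;
  adj_sym : symmetric adj;
  adj_irr : irreflexive adj }.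

Definition clique (G : sgraph) (K : {set G}) : bool :=
  [forall x in K, forall y in K, (x != y) ==> adj x y].

(* The system A_G x <= 1, x >= 0. *)
Definition clique_sys (G : sgraph) : linsys G :=
  @LinSys G
    ({K : {set G} | clique K} + G)%type
    (fun i v => match i with
                | inl K => (v \in val K)%:R
                | inr a => - (v == a)%:R
                end)
    (fun i => match i with
              | inl _ => 1
              | inr _ => 0
              end).

Definition box_perfect (G : sgraph) : Prop := box_TDI (clique_sys G).

Definition graph_iso (G H : sgraph) : Prop :=
  exists2 f : G -> H, bijective f & forall x y, adj (f x) (f y) = adj x y.

Section DelVertex.
Variables (G : sgraph) (a : G).

Definition del_adj : rel {x : G | x != a} := fun x y => adj (val x) (val y).

Fact del_adj_sym : symmetric del_adj.
Proof. by move=> x y; apply: adj_sym. Qed.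

Fact del_adj_irr : irreflexive del_adj.
Proof. by move=> x; apply: adj_irr. Qed.

Definition del_vertex : sgraph := SGraph del_adj_sym del_adj_irr.

End DelVertex.

(** * Total unimodularity and the class Q *)

Definition increasing p m (f : 'I_p -> 'I_m) : Prop :=
  forall i j : 'I_p, (i < j)%N -> (f i < f j)%N.

Definition totally_unimodular m n (M : 'M[int]_(m, n)) : Prop :=
  forall k (f : 'I_k -> 'I_m) (g : 'I_k -> 'I_n),
    increasing f -> increasing g -> \det (mxsub f g M) \in [:: 0; 1; -1].

(* A bipartite graph (U, V, E) with ordered bipartition is given by its
   edge relation E : U -> V -> bool. *)
Definition biadjacency (U V : finType) (E : U -> V -> bool) :
    'M[int]_(#|U|, #|V|) :=
  \matrix_(i, j) (E (enum_val i) (enum_val j))%:R.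

Definition class_Q (U V : finType) (E : U -> V -> bool) : Prop :=
  let M := biadjacency E in
  ~ totally_unimodular M /\
  forall p q (f : 'I_p -> 'I_#|U|) (g : 'I_q -> 'I_#|V|),
    increasing f -> increasing g -> (p < #|U|)%N || (q < #|V|)%N ->
    totally_unimodular (mxsub f g M).

(** * The class R *)

Section Glue.
Variables (U : finType) (G2 : sgraph) (E1 : U -> G2 -> bool).

Definition bip_nbh (u : U) : {set G2} := [set v | E1 u v].

Definition glue_adj : rel (U + G2)%type := fun x y =>
  match x, y with
  | inl _, inl _ => false
  | inl u, inr v => E1 u v
  | inr v, inl u => E1 u v
  | inr v, inr v' => adj v v'
  end.

Fact glue_adj_sym : symmetric glue_adj.
Proof. by move=> [u|v] [u'|v'] //=; apply: adj_sym. Qed.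

Fact glue_adj_irr : irreflexive glue_adj.
Proof. by move=> [u|v] //=; apply: adj_irr. Qed.

(* (U :|: V, E' :|: E'') for G' = (U, V, E') given by E1, G'' = G2. *)
Definition glue : sgraph := SGraph glue_adj_sym glue_adj_irr.

End Glue.

(* Closed under isomorphism, as vertex names are immaterial. *)
Inductive class_R (H : sgraph) : Prop :=
| class_R_del (U : finType) (G2 : sgraph) (E1 : U -> G2 -> bool) (u : U) of
    class_Q E1 &
    (forall x, clique (bip_nbh E1 x)) &
    bip_nbh E1 u = [set: G2] &
    graph_iso H (@del_vertex (glue E1) (inl u))
| class_R_all (U : finType) (G2 : sgraph) (E1 : U -> G2 -> bool) of
    class_Q E1 &
    (forall x, clique (bip_nbh E1 x)) &
    (forall x, bip_nbh E1 x <> [set: G2]) &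
    graph_iso H (glue E1).

(* Main.v *)
Require Import Defs.
From mathcomp Require Import all_boot all_order all_algebra.
From mathcomp Require Import constructive_ereal.

(** Box-total dual integrality is refuted on one face of the clique polytope.

    Let [x] be a positive point of the polytope and [A] a set of vertices.
    Bounding below by [x] exactly the coordinates outside [A] leaves, among the
    constraints that [x] satisfies with equality, the cliques of [x]-weight 1
    and one bound for each vertex outside [A].  By complementary slackness,
    as soon as one dual solution is supported on these constraints, the optimal
    ones are exactly those that are; and the multipliers of the bounds absorb whatever the cliques do outside
    [A].  So box-perfectness forces an integrality property of the tight
    cliques restricted to [A]: an integral vector on [A] that is a nonnegative
    combination of them is also an integral combination of them
    ([box_perfect_tight_integral]).

    For a graph of the class R take [A = V].  The point giving weight [1/d] to
    every vertex of [V] and [1 - |N(u)|/d] to every remaining [u] has for tight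
    cliques just the closed neighbourhoods of the [u] in [U], provided that
    [d = |V|] if some [u0] has [N(u0) = V] (its closed neighbourhood is then
    cut down to [V], as [u0] is deleted) and [d = |V| + 1] otherwise (so that
    [V], should it be a clique, is not tight); see [clique_weight].  Restricted
    to [V] these cliques are the rows of the biadjacency matrix [M].  By
    minimality the submatrix of [M] with a bad determinant is [M] itself
    ([not_class_Q]), so [M] is square and [M^-1] exists over the rationals but
    is not integral.  The fractional parts of a nonintegral row of [M^-1]
    combine the rows of [M] to an integral vector, and by uniqueness no
    integral combination gives it
    ([nonunimodular_fractional_combination]). *)

Set Implicit Arguments.
Unset Strict Implicit.
Unset Printing Implicit Defensive.

Import Order.TTheory GRing.Theory Num.Theory.
Local Open Scope ring_scope.

(** * Complementary slackness *)

Definition slack (V : finType) (S : linsys V) (x : V -> rat) (i : ineq S) : rat :=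
  rhs i - \sum_v lhs i v * x v.
Arguments slack [V] S x i.

Lemma dual_value_slack (V : finType) (S : linsys V) (w : V -> int)
    (x : V -> rat) (y : ineq S -> rat) :
  dual_feasible w y ->
  dual_value y = \sum_v (w v)%:~R * x v + \sum_i y i * slack S x i.
Proof.
move=> [_ yw]; rewrite /dual_value -[LHS](addrNK (\sum_i y i * slack S x i)).
congr (_ + _); rewrite -sumrB.
transitivity (\sum_i \sum_v y i * lhs i v * x v).
  apply: eq_bigr => i _; rewrite /slack mulrBr opprB addrC subrK mulr_sumr.
  by apply: eq_bigr => v _; rewrite mulrA.
by rewrite exchange_big; apply: eq_bigr => v _; rewrite -yw mulr_suml.
Qed.

(** Both halves come from [dual_value_slack]: a dual solution orthogonal to the
    slacks of a primal feasible point attains the lower bound given by that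
    point, and then every optimal one must be orthogonal to the slacks too. *)
Lemma complementary_slackness (V : finType) (S : linsys V) (w : V -> int)
    (x : V -> rat) (y : ineq S -> rat) :
  (forall i, 0 <= slack S x i) ->
  dual_feasible w y -> (forall i, y i * slack S x i = 0) ->
  dual_optimal w y /\
  (forall z, dual_optimal w z -> forall i, slack S x i != 0 -> z i = 0).
Proof.
move=> s_ge0 yf y0.
have yval : dual_value y = \sum_v (w v)%:~R * x v.
  by rewrite (dual_value_slack x yf) [X in _ + X]big1 ?addr0.
split=> [|z [zf zopt] i si].
  split=> // t tf; rewrite yval (dual_value_slack x tf) lerDl sumr_ge0 // => i _.
  by rewrite mulr_ge0 //; case: tf.
have zi_ge0 j : true -> 0 <= z j * slack S x j by rewrite mulr_ge0 //; case: zf.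
have z0 : \sum_j z j * slack S x j = 0.
  apply/eqP; rewrite eq_le sumr_ge0 // andbT.
  by have := zopt _ yf; rewrite yval (dual_value_slack x zf) gerDl.
by have /eqP := psumr_eq0P zi_ge0 z0 (erefl (true : bool)) (i := i);
  rewrite mulf_eq0 (negPf si) orbF => /eqP.
Qed.

(** * What box-perfectness says about tight cliques *)

Definition tight_cliques (G : sgraph) (x : G -> rat) : {set {set G}} :=
  [set K | clique K & \sum_(v in K) x v == 1].

(** The box bounds from below, by [x], the coordinates outside [A] only.  Since
    [x] is positive, the optimal dual solutions for a suitable [w] live on the
    tight cliques and on these bounds, and the bounds do not touch the dual
    constraints of [A]; an integral optimum thus yields [z].  The vector [w] is
    the given combination on [A], and [0] outside, where the multiplier of the
    bound cancels the combination. *)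
Lemma box_perfect_tight_integral (G : sgraph) (x : G -> rat) (A : {set G})
    (y : {set G} -> rat) :
  box_perfect G ->
  (forall v, 0 < x v) ->
  (forall K : {set G}, clique K -> \sum_(v in K) x v <= 1) ->
  (forall K, 0 <= y K) ->
  (forall v, v \in A ->
     \sum_(K in tight_cliques x) y K * (v \in K)%:R \is a Num.int) ->
  exists2 z : {set G} -> rat, forall K, z K \is a Num.int &
    forall v, v \in A ->
      \sum_(K in tight_cliques x) z K * (v \in K)%:R =
      \sum_(K in tight_cliques x) y K * (v \in K)%:R.
Proof.
set T := tight_cliques x => Gbp x_gt0 xK y_ge0 yint.
pose l v : \bar rat := if v \in A then -oo%E else (x v)%:E.
pose u (v : G) : \bar rat := +oo%E.
pose S := add_box (clique_sys G) l u.
pose g v := \sum_(K in T) y K * (v \in K)%:R.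
pose w v : int := if v \in A then Num.floor (g v) else 0.
pose Y (i : ineq S) : rat := match i with
  | inl (inl K) => if val K \in T then y (val K) else 0
  | inr (inl a) => g (val a)
  | _ => 0 end.
have g_ge0 v : 0 <= g v by rewrite sumr_ge0 // => K _; rewrite mulr_ge0.
have lE v : (l v \is a fin_num) = (v \notin A).
  by rewrite /l; case: (v \in A).
have noU (a : {v : G | u v \is a fin_num}) : False by case: a.
(* The dual constraint of v, split by kind of inequality: cliques,
   nonnegativity, lower bounds (there are no upper bounds). *)
have colE (t : ineq S -> rat) (v : G) : \sum_i t i * lhs i v =
    \sum_(K : {K : {set G} | clique K}) t (inl (inl K)) * (v \in val K)%:R
    - t (inl (inr v))
    - (\sum_(a : {v : G | l v \is a fin_num}) t (inr (inl a)) * (v == val a)%:R).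
  rewrite !big_sumType /= -!addrA; congr (_ + _); congr (_ + _).
    rewrite (bigD1 v) //= eqxx mulrN1 big1 ?addr0 // => a /negPf.
    by rewrite eq_sym => ->; rewrite oppr0 mulr0.
  rewrite [X in _ + X]big1 ?addr0; last by move=> a _; case: (noU a).
  by rewrite -sumrN; apply: eq_bigr => a _; rewrite mulrN.
have boxE (F : G -> rat) v :
    \sum_(a : {v : G | l v \is a fin_num}) F (val a) * (v == val a)%:R =
    if v \in A then 0 else F v.
  rewrite -(big_sub [pred v | l v \is a fin_num] (fun a => F a * (v == a)%:R)).
  rewrite big_mkcond (bigD1 v) //= inE lE eqxx mulr1 big1 ?addr0 => [|a].
    by case: (v \in A).
  by rewrite eq_sym => /negPf ->; rewrite mulr0 if_same.
have cliqueE (F : {set G} -> rat) (v : G) :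
    \sum_(K : {K : {set G} | clique K})
       (if val K \in T then F (val K) else 0) * (v \in val K)%:R =
    \sum_(K in T) F K * (v \in K)%:R.
  rewrite -(big_sub [pred K : {set G} | clique K]
     (fun K => (if K \in T then F K else 0) * (v \in K)%:R)).
  rewrite big_mkcond [RHS]big_mkcond; apply: eq_bigr => K _.
  by rewrite !inE; case: (clique K); case: (_ == 1); rewrite /= ?mul0r.
have Yf : dual_feasible w Y.
  split=> [[[K|a]|[a|a]] //= | v]; first by case: ifP.
  rewrite colE /= cliqueE boxE subr0 /w; case: ifP => vA; last by rewrite subrr.
  by rewrite subr0; apply/esym/eqP; rewrite -intrEfloor yint.
have slackK (K : {K : {set G} | clique K}) :
    slack S x (inl (inl K)) = 1 - \sum_(v in val K) x v.
  rewrite /slack /=; congr (_ - _); rewrite [RHS]big_mkcond.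
  by apply: eq_bigr => v _; case: (v \in _); rewrite ?mul1r ?mul0r.
have sumx (b : G) : \sum_v - (v == b)%:R * x v = - x b.
  rewrite (bigD1 b) //= eqxx mulN1r big1 ?addr0 // => v /negPf ->.
  by rewrite oppr0 mul0r.
have slackx (b : G) : slack S x (inl (inr b)) = x b.
  by rewrite /slack /= sumx opprK add0r.
have slackl (a : {v : G | l v \is a fin_num}) : slack S x (inr (inl a)) = 0.
  rewrite /slack /= sumx opprK; have := valP a.
  by rewrite lE /l => /negPf ->; rewrite /= addNr.
have s_ge0 i : 0 <= slack S x i.
  case: i => [[K|b]|[a|a]]; last by case: (noU a).
  - by rewrite slackK subr_ge0 xK // (valP K).
  - by rewrite slackx ltW.
  - by rewrite slackl.
have Y0 i : Y i * slack S x i = 0.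
  case: i => [[K|b]|[a|a]] /=; rewrite ?mul0r // ?slackl ?mulr0 //.
  by rewrite slackK inE; case: eqP => [->|]; rewrite ?subrr ?mulr0 // andbF mul0r.
have Yopt := complementary_slackness s_ge0 Yf Y0.
have lneq v : l v != +oo%E by rewrite /l; case: ifP.
have uneq v : u v != -oo%E by [].
have [t topt tint] := Gbp l u lneq uneq w (ex_intro _ Y Yopt.1).
have t0 := Yopt.2 t topt.
pose z K := if insub K is Some k then t (inl (inl k)) else 0.
exists z => [K | v vA]; first by rewrite /z; case: insubP.
have := topt.1.2 v; rewrite -Yf.2 !colE.
have -> : t (inl (inr v)) = 0 by apply: t0; rewrite slackx gt_eqF.
rewrite /= cliqueE; rewrite !subr0.
have noA (F : {v : G | l v \is a fin_num} -> rat) :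
    \sum_a F a * (v == val a)%:R = 0.
  rewrite big1 // => a _; case: eqP => [va|_]; last by rewrite mulr0.
  by have := valP a; rewrite lE -va vA.
rewrite !noA !subr0 => <-; rewrite -cliqueE; apply: eq_bigr => K _.
rewrite /z valK; case: ifPn => // KT; rewrite t0 // slackK subr_eq0.
by move: KT; rewrite inE (valP K) /= eq_sym.
Qed.

(** * From class Q to fractional combinations *)

(** If [M^-1] were integral, [det M] would be a unit of the integers.  So some
    row of [M^-1] has a nonintegral entry; its product with [M] is integral, and
    remains so after replacing its entries by their fractional parts, which
    makes them nonnegative.  Invertibility makes the combination unique. *)
Lemma nonunimodular_fractional_combination k (M : 'M[int]_k) :
  \det M \notin [:: 0; 1; -1] ->
  exists y : 'I_k -> rat,
    [/\ forall i, 0 <= y i,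
        forall j, \sum_i y i * (M i j)%:~R \is a Num.int &
        ~ exists2 z : 'I_k -> rat, forall i, z i \is a Num.int &
            forall j, \sum_i z i * (M i j)%:~R = \sum_i y i * (M i j)%:~R].
Proof.
rewrite !inE !negb_or => /and3P[d0 d1 dN1].
pose A : 'M[rat]_k := map_mx intr M.
have detA : \det A = (\det M)%:~R by rewrite det_map_mx.
have Au : A \in unitmx by rewrite unitmxE unitfE detA intr_eq0.
have [/forallP allint | ] := boolP [forall i, forall j, invmx A i j \is a Num.int].
  pose N : 'M[int]_k := \matrix_(i, j) Num.floor (invmx A i j).
  have NE : invmx A = map_mx intr N.
    apply/matrixP => i j; rewrite !mxE; apply/esym/eqP.
    by rewrite -intrEfloor; have /forallP := allint i.
  have : \det N * \det M = 1.
    apply: (@intr_inj rat); rewrite rmorphM /= -!det_map_mx -NE -det_mulmx.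
    by rewrite mulVmx // det1.
  move/eqP => dd; have : \det M \is a GRing.unit.
    by apply/unitrP; exists (\det N); split; rewrite ?(mulrC (\det M)); apply/eqP.
  by case/orP => dE; rewrite dE in d1 dN1.
rewrite negb_forall => /existsP[i0]; rewrite negb_forall => /existsP[j0 nint].
pose f i : rat := (Num.floor (invmx A i0 i))%:~R.
exists (fun i => invmx A i0 i - f i); split=> [i | j | [z zint zE]].
- by rewrite subr_ge0 floor_le.
- under eq_bigr do rewrite mulrBl.
  rewrite sumrB rpredB //; last first.
    by rewrite rpred_sum // => i _; rewrite rpredM // ?rpred_int // /f ?intr_int.
  have -> : \sum_i invmx A i0 i * (M i j)%:~R = (invmx A *m A) i0 j.
    by rewrite mxE; apply: eq_bigr => i _; rewrite !mxE.
  by rewrite mulVmx // mxE rpred_nat.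
have : (\row_i (z i + f i)) *m A = row i0 (invmx A) *m A.
  apply/rowP => j; rewrite !mxE.
  under eq_bigr do rewrite !mxE mulrDl.
  rewrite big_split /= zE -big_split /=; apply: eq_bigr => i _.
  by rewrite !mxE -mulrDl subrK.
move/(congr1 (mulmx^~ (invmx A))); rewrite /= -!mulmxA mulmxV // !mulmx1.
move/rowP/(_ j0); rewrite !mxE => E; case/negP: nint.
by rewrite -E rpredD // /f intr_int.
Qed.

Lemma increasing_inj p m (f : 'I_p -> 'I_m) : increasing f -> injective f.
Proof.
move=> fi i j fij; apply/val_inj; case: (ltngtP i j) => // /fi;
  by rewrite fij ltnn.
Qed.

(** A bad submatrix of the biadjacency matrix cannot be proper, so it uses all
    rows and columns.  The contrapositive form avoids extracting it from a
    negated universal statement; that [r] and [c] are bijections from the same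
    ['I_k] encodes that the matrix is square. *)
Lemma not_class_Q (U V : finType) (E : U -> V -> bool) :
  (forall k (r : 'I_k -> U) (c : 'I_k -> V), bijective r -> bijective c ->
     \det (\matrix_(i, j) (E (r i) (c j))%:R : 'M[int]_k) \in [:: 0; 1; -1]) ->
  ~ class_Q E.
Proof.
move=> dets [nTU minTU]; apply: nTU => k f g fi gi.
have [small | ] := boolP ((k < #|U|)%N || (k < #|V|)%N).
  have := minTU k k f g fi gi small k id id (fun _ _ => id) (fun _ _ => id).
  by rewrite mxsub_id.
rewrite negb_or -!leqNgt => /andP[leU leV].
have rb : bijective (enum_val \o f : 'I_k -> U).
  by apply: inj_card_bij; rewrite ?card_ord //; apply: inj_comp;
     [apply: enum_val_inj | apply: increasing_inj].
have cb : bijective (enum_val \o g : 'I_k -> V).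
  by apply: inj_card_bij; rewrite ?card_ord //; apply: inj_comp;
     [apply: enum_val_inj | apply: increasing_inj].
have := dets k _ _ rb cb.
rewrite (_ : mxsub f g _ =
  \matrix_(i, j) (E ((enum_val \o f) i) ((enum_val \o g) j))%:R) //.
by apply/matrixP => i j; rewrite !mxE.
Qed.

(** Two equal rows would make the determinant of the whole biadjacency matrix,
    the only one that is not allowed to be [0], [1] or [-1], vanish. *)
Lemma class_Q_nbh_inj (U V : finType) (E : U -> V -> bool) (u u' : U) :
  class_Q E -> E u =1 E u' -> u = u'.
Proof.
move=> EQ Euu'; apply/eqP/negPn/negP => neq_uu'; move: EQ.
apply: not_class_Q => k r c [r' rK r'K] _.
rewrite (@determinant_alternate _ _ _ (r' u) (r' u')) ?inE ?eqxx //.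
  by rewrite (can_eq r'K).
by move=> j; rewrite !mxE !r'K Euu'.
Qed.

(** * A face of the clique polytope of a glued graph *)

Lemma cliqueP (G : sgraph) (K : {set G}) :
  reflect {in K &, forall a b, a != b -> adj a b} (clique K).
Proof.
apply: (iffP forall_inP) => [H a b aK bK|H a aK].
  by have /forall_inP/(_ b bK)/implyP := H a aK.
by apply/forall_inP => b bK; apply/implyP; apply: H.
Qed.

Definition closed_nbh (U : finType) (G2 : sgraph) (E1 : U -> G2 -> bool)
    (u : U) : {set glue E1} :=
  [set p | match p with inl u' => u' == u | inr v => E1 u v end].

(** The vertices of [U] get what is missing for the closed neighbourhoods to
    have weight 1. *)
Definition face_point (U : finType) (G2 : sgraph) (E1 : U -> G2 -> bool) (d : nat)
    (p : glue E1) : rat :=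
  match p with
  | inl u => 1 - #|bip_nbh E1 u|%:R / d%:R
  | inr _ => d%:R^-1
  end.

Lemma sum_face_point (U : finType) (G2 : sgraph) (E1 : U -> G2 -> bool) (d : nat)
    (P : {set glue E1}) :
  \sum_(p in P) face_point d p =
  \sum_(u | inl u \in P) (1 - #|bip_nbh E1 u|%:R / d%:R)
  + #|[set v : G2 | inr v \in P]|%:R / d%:R.
Proof.
rewrite big_sumType /=; congr (_ + _).
by rewrite mulr_natl -sumr_const; apply: eq_bigl => v; rewrite inE.
Qed.

Lemma clique_closed_nbh (U : finType) (G2 : sgraph) (E1 : U -> G2 -> bool)
    (u : U) :
  clique (bip_nbh E1 u) -> clique (closed_nbh E1 u).
Proof.
move=> /cliqueP Nu; apply/cliqueP => -[a|a] [b|b]; rewrite !inE //=.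
- by move=> /eqP-> /eqP->; rewrite eqxx.
- by move=> /eqP->.
- by move=> ua /eqP->.
- by move=> ua ub neq; apply: Nu; rewrite ?inE.
Qed.

(** As [U] is stable, a clique meeting [U] lies in a closed neighbourhood, and a
    clique inside [V] has weight at most [|V| / d].  Removing vertices of [V]
    lowers the weight, hence the equality cases. *)
Lemma clique_weight (U : finType) (G2 : sgraph) (E1 : U -> G2 -> bool) (d : nat)
    (P : {set glue E1}) :
  (#|G2| <= d)%N -> clique P ->
  \sum_(p in P) face_point d p <= 1 /\
  (\sum_(p in P) face_point d p = 1 ->
     (exists u, P = closed_nbh E1 u) \/
     (#|G2| = d /\ P = [set p | if p is inr _ then true else false])).
Proof.
move=> le_d /cliqueP Pcl; rewrite sum_face_point.
set P2 := [set v | _].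
have [/existsP[u uP] | noU] := boolP [exists u : U, inl u \in P].
  have P1 u' : (inl u' \in P) = (u' == u).
    apply/idP/eqP => [u'P | -> //]; apply/eqP/negPn/negP => neq.
    suff: false by [].
    by apply: Pcl uP u'P _; apply: contra neq => /eqP[->].
  have P2N : P2 \subset bip_nbh E1 u.
    apply/subsetP => v; rewrite !inE => vP.
    exact: Pcl uP vP _.
  rewrite (eq_bigl (pred1 u)) // big_pred1_eq -addrA gerDl addrC subr_le0.
  rewrite ler_wpM2r ?invr_ge0 ?ler0n ?ler_nat ?subset_leq_card //; split=> //.
  move=> /eqP; rewrite -[X in _ == X]addr0.
  rewrite (inj_eq (addrI _)) subr_eq0 => card_eq; left; exists u.
  suff PN : P2 = bip_nbh E1 u.
    apply/setP => -[u'|v]; rewrite inE ?P1 //.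
    by have /setP/(_ v) := PN; rewrite !inE.
  apply/eqP; rewrite eqEcard P2N /=; have [d0 | d_gt0] := posnP d.
    by rewrite (leq_trans (max_card _)) // (leq_trans le_d) ?d0.
  move: card_eq; rewrite (inj_eq (mulIf _)) ?invr_eq0 ?pnatr_eq0 -?lt0n //.
  by rewrite eqr_nat => /eqP->.
have P1 u : (inl u \in P) = false.
  by apply/negP => uP; case/negP: noU; apply/existsP; exists u.
rewrite big_pred0 // add0r.
have le_P2 : (#|P2| <= d)%N := leq_trans (max_card _) le_d.
have [d0 | d_gt0] := posnP d.
  by rewrite d0 invr0 mulr0 ler01; split=> // /esym/eqP; rewrite oner_eq0.
rewrite ler_pdivrMr ?ltr0n // mul1r ler_nat le_P2; split=> //.
move/(canRL (divfK _)); rewrite mul1r pnatr_eq0 -lt0n => /(_ d_gt0)/eqP.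
rewrite eqr_nat => /eqP cardP2; right.
have card_d : #|G2| = d.
  by apply/eqP; rewrite eqn_leq le_d -cardP2 max_card.
split=> //; apply/setP => -[u|v]; rewrite inE ?P1 //.
have /eqP P2T : P2 == setT by rewrite eqEcard subsetT cardsT card_d cardP2 /=.
by have := in_setT v; rewrite -P2T inE.
Qed.

(** * The obstruction *)

(** Stating this for an embedding [phi] of [H] in the glued graph, whose image
    misses exactly the vertices of [U] adjacent to all of [V], covers at once
    both constructions of the class R and its closure under isomorphism. *)
Lemma glue_embedding_not_box_perfect (U : finType) (G2 : sgraph)
    (E1 : U -> G2 -> bool) (H : sgraph) (phi : H -> glue E1) :
  class_Q E1 -> (forall u, clique (bip_nbh E1 u)) ->
  injective phi -> (forall h h', adj (phi h) (phi h') = adj h h') ->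
  (forall p, (p \in codom phi) =
     if p is inl u then bip_nbh E1 u != setT else true) ->
  ~ box_perfect H.
Proof.
move=> E1Q clN phi_inj phi_adj phi_im Hbp; apply: (not_class_Q _ E1Q).
move=> k r c rb [c' cK c'K]; apply/negPn/negP.
move/nonunimodular_fractional_combination.
set M := \matrix_(i, j) _ => -[y [y_ge0 yint]]; apply.
(* d = |V| keeps the clique V tight, replacing the deleted vertex; otherwise
   d = |V| + 1 makes every clique inside V slack. *)
pose d := (#|G2| + ~~ [exists u, bip_nbh E1 u == setT])%N.
have le_d : (#|G2| <= d)%N by rewrite leq_addr.
pose x h := face_point d (phi h).
have weight (K : {set H}) : \sum_(h in K) x h = \sum_(p in phi @: K) face_point d p.
  by rewrite big_imset //=; apply: in2W.
have clique_im (K : {set H}) : clique K -> clique (phi @: K).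
  move=> /cliqueP Kcl; apply/cliqueP => _ _ /imsetP[a aK ->] /imsetP[b bK ->].
  by rewrite (inj_eq phi_inj) phi_adj; apply: Kcl.
pose KK u := phi @^-1: closed_nbh E1 u.
have KK_clique u : clique (KK u).
  have /cliqueP ucl := clique_closed_nbh (clN u).
  apply/cliqueP => a b aK bK; rewrite inE in aK; rewrite inE in bK.
  by rewrite -phi_adj -(inj_eq phi_inj); apply: ucl.
have KKv u h v : phi h = inr v -> (h \in KK u) = E1 u v.
  by move=> hv; rewrite inE hv inE.
have inrP v : exists h, phi h = inr v.
  have : inr v \in codom phi by rewrite phi_im.
  by case/codomP=> h ->; exists h.
(* Cliques are indexed as sets in the linear system: injectivity is what
   makes the tight cliques correspond one to one to the rows of M. *)
have KK_inj : injective KK.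
  move=> u u' eqKK; apply: class_Q_nbh_inj E1Q _ => v.
  by have [h hv] := inrP v; rewrite -!(KKv _ _ _ hv) eqKK.
have x_gt0 h : 0 < x h.
  rewrite /x; have := codom_f phi h; rewrite phi_im.
  case: (phi h) => [u uT | v _] /=; last first.
    by rewrite invr_gt0 ltr0n (leq_trans _ le_d) //; apply/card_gt0P; exists v.
  have lt_d : (#|bip_nbh E1 u| < d)%N.
    by rewrite (leq_trans _ le_d) // -cardsT proper_card // properT.
  by rewrite subr_gt0 ltr_pdivrMr ?ltr0n ?(leq_trans _ lt_d) // mul1r ltr_nat.
have KK1 u : \sum_(h in KK u) x h = 1.
  rewrite weight sum_face_point.
  have KKim p :
      (p \in phi @: KK u) = (p \in closed_nbh E1 u) && (p \in codom phi).
    apply/imsetP/andP => [[h hK ->]|[pu /codomP[h E]]].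
      by rewrite codom_f; rewrite inE in hK.
    by exists h => //; rewrite inE -E.
  have -> : [set v | inr v \in phi @: KK u] = bip_nbh E1 u.
    by apply/setP => v; rewrite !inE KKim inE phi_im andbT.
  (* If N(u) = V, then u is outside the image and only V, of weight
     |V| / d = 1, remains. *)
  have [uT | uT] := eqVneq (bip_nbh E1 u) setT.
    rewrite big_pred0 => [|u']; last first.
      by rewrite KKim inE phi_im; case: eqP => // ->; rewrite uT eqxx.
    have dE : d = #|G2|.
      rewrite /d; case: existsP => [|[]]; first by rewrite addn0.
      by exists u; apply/eqP.
    have [r' _ _] := rb.
    have d_gt0 : (0 < d)%N.
      by rewrite dE; apply/card_gt0P; exists (c (r' u)).
    by rewrite uT cardsT dE add0r divff // pnatr_eq0 -dE -lt0n.
  rewrite (eq_bigl (pred1 u)) ?big_pred1_eq ?subrK // => u'.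
  by rewrite KKim inE phi_im /=; case: eqP => // ->.
have x_le1 (K : {set H}) : clique K -> \sum_(h in K) x h <= 1.
  by move=> Kcl; rewrite weight; apply: (clique_weight le_d (clique_im _ Kcl)).1.
have tightE : tight_cliques x = [set KK (r i) | i in 'I_k].
  apply/setP => K; apply/idP/imsetP => [|[i _ ->]]; last first.
    by rewrite inE KK_clique KK1 eqxx.
  rewrite inE => /andP[Kcl /eqP]; rewrite weight => K1.
  have [r' rK r'K] := rb.
  suff [u ->] : exists u, K = KK u by exists (r' u); rewrite ?r'K.
  have preimK : K = phi @^-1: (phi @: K).
    by apply/setP => h; rewrite inE mem_imset.
  case: ((clique_weight le_d (clique_im _ Kcl)).2 K1) => [[u Ku]|[dE KV]].
    by exists u; rewrite preimK Ku.
  have /existsP[u /eqP uT] : [exists u, bip_nbh E1 u == setT].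
    by apply: contra_eqT dE; rewrite /d => ->; rewrite addn1 neq_ltn ltnSn.
  exists u; apply/setP => h; rewrite preimK KV !inE.
  have := codom_f phi h; rewrite phi_im; case: (phi h) => [u' u'T|v _].
    by apply/esym/negbTE; apply: contra u'T => /eqP ->; rewrite uT.
  by have := in_setT v; rewrite -uT inE => ->.
have KKr_inj : injective (KK \o r) := inj_comp KK_inj (bij_inj rb).
have sumE (t : {set H} -> rat) h v : phi h = inr v ->
    \sum_(K in tight_cliques x) t K * (h \in K)%:R =
    \sum_i t (KK (r i)) * (M i (c' v))%:~R.
  move=> hv; rewrite tightE big_imset /=; last by apply: in2W.
  by apply: eq_bigr => i _; rewrite (KKv _ _ _ hv) mxE c'K; case: (E1 _ _).
(* As KK \o r is injective, this sum has at most one term. *)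
pose Y K := \sum_(i | KK (r i) == K) y i.
have YE i : Y (KK (r i)) = y i.
  by rewrite /Y (eq_bigl (pred1 i)) ?big_pred1_eq // => j; rewrite (inj_eq KKr_inj).
pose A := [set h | if phi h is inr _ then true else false].
have AP h : h \in A -> exists v, phi h = inr v.
  by rewrite inE; case: (phi h) => // v _; exists v.
have Y_ge0 K : 0 <= Y K by rewrite sumr_ge0.
have Yint h : h \in A ->
    \sum_(K in tight_cliques x) Y K * (h \in K)%:R \is a Num.int.
  case/AP => v hv; rewrite (sumE _ _ _ hv).
  by under eq_bigr do rewrite YE; apply: yint.
have [z zint zE] := box_perfect_tight_integral Hbp x_gt0 x_le1 Y_ge0 Yint.
exists (z \o KK \o r) => [i | j]; first exact: zint.
have [h hc] := inrP (c j).
have := zE h; rewrite inE hc => /(_ isT); rewrite !(sumE _ _ _ hc) cK.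
by under [RHS]eq_bigr do rewrite YE.
Qed.

Theorem lemma2p2 (G : sgraph) (hG : class_R G) : ~ box_perfect G.
Proof.
case: hG => [U G2 E1 u0 E1Q clN u0T [f f_bij f_adj]
            |U G2 E1 E1Q clN noT [f f_bij f_adj]].
  apply: (@glue_embedding_not_box_perfect _ _ E1 _ (val \o f)) => //.
    exact: inj_comp val_inj (bij_inj f_bij).
  have [g _ gK] := f_bij.
  (* Distinct vertices of U have distinct neighbourhoods, so u0 is the only
     one adjacent to all of V. *)
  have imE p : (p \in codom (val \o f)) = (p != inl u0).
    apply/codomP/idP => [[h ->]|pu]; first exact: (valP (f h)).
    by exists (g (Sub p pu)); rewrite /= gK.
  move=> p; rewrite imE; case: p => // u; congr (~~ _).
  apply/eqP/eqP => [[->] // | uT]; congr inl; apply: class_Q_nbh_inj E1Q _ => v.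
  by have /setP/(_ v) := uT; rewrite -u0T !inE.
apply: (@glue_embedding_not_box_perfect _ _ E1 _ f) => //.
  exact: bij_inj.
have [g _ gK] := f_bij.
move=> p; rewrite -[p in LHS]gK codom_f.
by case: p => // u; apply/esym/eqP.
Qed.
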